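(* Let $\mathbf{X}_1,\dots,\mathbf{X}_n\in\mathbb{R}^d$ and suppose the loss $\rho$ satisfies: (A1) $\rho$ is non-decreasing, $\rho(0)=0$, and $\rho(x)/x\to 0$ as $x\to 0$; (A2) $\varphi(0)\triangleq\lim_{x\to 0}\psi(x)/x$ exists and is finite; (A3) $\psi$ and $\varphi$ are continuous; and suppose $\varphi$ is nonincreasing. Let $$\mathcal{S}=\{g\in\mathcal{H}\mid V(g)=\mathbf{0}\},\qquad V(g)=\frac1n\sum_{i=1}^n\varphi(\|\Phi(\mathbf{X}_i)-g\|_{\mathcal{H}})\cdot(\Phi(\mathbf{X}_i)-g),$$ and let $\{f^{(k)}\}_{k=1}^\infty$ be the sequence produced by the KIRWLS algorithm. Then $J(f^{(k)})$ monotonically decreases at every iteration (i.e. $J(f^{(k+1)})\le J(f^{(k)})$ for all $k\geq 1$) and converges. Also, $\mathcal{S}\ne\emptyset$ and $$\|f^{(k)}-\mathcal{S}\|_{\mathcal{H}}\triangleq\inf_{g\in\mathcal{S}}\|f^{(k)}-g\|_{\mathcal{H}}\to 0\quad\text{as }k\to\infty.$$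
   Context: The kernel $k_\sigma:\mathbb{R}^d\times\mathbb{R}^d\to[0,\infty)$ satisfies $\int k_\sigma(\mathbf{x},\cdot)\,d\mathbf{x}=1$, is radial, meaning $k_\sigma(\mathbf{x},\mathbf{x}')=g_0(\|\mathbf{x}-\mathbf{x}'\|^2)$ for some function $g_0$, and is positive semi-definite. $\mathcal{H}$ is the reproducing kernel Hilbert space (real) associated with $k_\sigma$, and $\Phi(\mathbf{x})\triangleq k_\sigma(\cdot,\mathbf{x})\in\mathcal{H}$ is the canonical feature map. The loss $\rho:[0,\infty)\to\mathbb{R}$ is differentiable, $\psi\triangleq\rho'$, and $\varphi(x)\triangleq\psi(x)/x$ for $x>0$. The objective is $J(g)=\frac1n\sum_{i=1}^n\rho(\|\Phi(\mathbf{X}_i)-g\|_{\mathcal{H}})$, $g\in\mathcal{H}$. The KIRWLS (kernelized iteratively re-weighted least squares) algorithm starts with initial weights $w_i^{(0)}\in\mathbb{R}$, $i=1,\dots,n$, with $w_i^{(0)}\ge 0$ and $\sum_{i=1}^n w_i^{(0)}=1$, and generates $\{f^{(k)}\}_{k\ge1}$ by iterating $$f^{(k)}=\sum_{i=1}^n w_i^{(k-1)}\Phi(\mathbf{X}_i),\qquad w_i^{(k)}=\frac{\varphi(\|\Phi(\mathbf{X}_i)-f^{(k)}\|_{\mathcal{H}})}{\sum_{j=1}^n\varphi(\|\Phi(\mathbf{X}_j)-f^{(k)}\|_{\mathcal{H}})}.$$ *)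

(* Defs.v *)
From HB Require Import structures.
From mathcomp Require Import all_boot all_order all_algebra.
From mathcomp Require Import all_classical all_reals all_analysis.
Set Implicit Arguments.
Unset Strict Implicit.
Unset Printing Implicit Defensive.
Import Order.TTheory GRing.Theory Num.Theory.
Import numFieldNormedType.Exports.
Local Open Scope classical_set_scope.
Local Open Scope ring_scope.

(* Points of R^d are d-tuples: the library equips them with the product of the
   Borel sigma-algebras, and, unlike 'rV[R]_d, with no (supremum) norm. *)
Section euclidean_space.
Variable R : realType.

Definition sqdist (d : nat) (x y : d.-tuple R) : R :=
  \sum_(i < d) (tnth x i - tnth y i) ^+ 2.

Definition tcons (d : nat) (p : d.-tuple R * measurableTypeR R) : d.+1.-tuple R :=
  [tuple of p.2 :: p.1].

Lemma measurable_tcons (d : nat) :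
  measurable_fun [set: d.-tuple R * measurableTypeR R] (@tcons d).
Proof. exact: measurable_cons. Qed.

(* If mu is Lebesgue measure on R^d, this is Lebesgue measure on R^(d+1). *)
Definition lebesgue_succ (d : nat) (mu : {measure set (d.-tuple R) -> \bar R}) :
    set (d.+1.-tuple R) -> \bar R :=
  pushforward (mu \x @lebesgue_measure R)%E (@tcons d).

Section lebesgue_succ_measure.
Variables (d : nat) (mu : {measure set (d.-tuple R) -> \bar R}).

Let lebesgue_succ0 : lebesgue_succ mu set0 = 0%E.
Proof. by apply: measure0; exact: measurable_tcons. Qed.

Let lebesgue_succ_ge0 A : (0 <= lebesgue_succ mu A)%E.
Proof. by apply: measure_ge0; exact: measurable_tcons. Qed.

Let lebesgue_succ_sigma_additive : semi_sigma_additive (lebesgue_succ mu).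
Proof.
by apply: measure_semi_sigma_additive; exact: measurable_tcons.
Qed.

HB.instance Definition _ := isMeasure.Build _ _ _ (lebesgue_succ mu)
  lebesgue_succ0 lebesgue_succ_ge0 lebesgue_succ_sigma_additive.

End lebesgue_succ_measure.

Fixpoint lebesgue_tuple (d : nat) : {measure set (d.-tuple R) -> \bar R} :=
  match d with
  | 0%N => dirac ([tuple] : 0.-tuple R)
  | m.+1 => lebesgue_succ (lebesgue_tuple m)
  end.

End euclidean_space.

Section kernel.
Variables (R : realType) (d : nat) (k : d.-tuple R -> d.-tuple R -> R).

(* Measurability is part of the claim that k x integrates to 1: the library's
   integral of a nonmeasurable nonnegative function is a lower integral. *)
Definition kernel_normalized : Prop :=
  forall x, measurable_fun [set: d.-tuple R] (k x) /\
            (\int[lebesgue_tuple R d]_y (k x y)%:E)%E = 1%E.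

Definition kernel_radial : Prop :=
  exists g0 : R -> R, forall x y, k x y = g0 (sqdist x y).

Definition kernel_psd : Prop :=
  forall (m : nat) (x : 'I_m -> d.-tuple R) (c : 'I_m -> R),
    0 <= \sum_(i < m) \sum_(j < m) c i * c j * k (x i) (x j).

End kernel.

(* A real Hilbert space whose vectors are, through the injective linear map
   [rkhs_eval], functions on T; [feature x] is the function k(., x). *)
Record rkhs (R : realType) (T : Type) (k : T -> T -> R) := Rkhs {
  rkhs_space :> completeNormedModType R;
  rkhs_dot : {dot rkhs_space for (@idfun R)};
  rkhs_normE : forall g : rkhs_space, `|g| ^+ 2 = rkhs_dot g g;
  rkhs_eval : rkhs_space -> T -> R;
  rkhs_eval_linear : forall (a : R) (g h : rkhs_space) (x : T),
    rkhs_eval (a *: g + h) x = a * rkhs_eval g x + rkhs_eval h x;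
  rkhs_eval_inj : injective rkhs_eval;
  feature : T -> rkhs_space;
  feature_eval : forall x y : T, rkhs_eval (feature x) y = k y x;
  rkhs_reproducing : forall (g : rkhs_space) (x : T),
    rkhs_eval g x = rkhs_dot g (feature x)
}.

(* A loss on [0, +oo[ is a function on R of which only the values on [0, +oo[
   matter; in particular its derivative at 0 is the right derivative. *)
Section loss.
Variables (R : realType) (rho : R -> R).

Definition loss_quotient (x y : R) : R := (rho y - rho x) / (y - x).

Definition loss_differentiable : Prop :=
  forall x, 0 <= x ->
    cvg (loss_quotient x y @[y --> within [set y | 0 <= y] x^']).

Definition psi (x : R) : R :=
  lim (loss_quotient x y @[y --> within [set y | 0 <= y] x^']).

Definition varphi (x : R) : R :=
  if x == 0 then lim (psi y / y @[y --> 0^'+]) else psi x / x.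

Definition assumption_A1 : Prop :=
  [/\ forall x y, 0 <= x -> x <= y -> rho x <= rho y,
      rho 0 = 0
    & rho x / x @[x --> 0^'+] --> (0 : R)].

Definition assumption_A2 : Prop := cvg (psi x / x @[x --> 0^'+]).

Definition assumption_A3 : Prop :=
  {within [set x : R | 0 <= x], continuous psi} /\
  {within [set x : R | 0 <= x], continuous varphi}.

Definition varphi_nonincreasing : Prop :=
  forall x y, 0 <= x -> x <= y -> varphi y <= varphi x.

End loss.

Section kirwls.
Variables (R : realType) (T : Type) (k : T -> T -> R) (H : rkhs k).
Variables (rho : R -> R) (n : nat) (X : 'I_n -> T).

Definition objective (g : H) : R :=
  n%:R^-1 * \sum_(i < n) rho `|feature H (X i) - g|.

Definition V (g : H) : H :=
  n%:R^-1 *: \sum_(i < n)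
    varphi rho `|feature H (X i) - g| *: (feature H (X i) - g).

Definition stationary : set H := [set g | V g = 0].

Definition set_dist (f : H) (S : set H) : R := inf [set `|f - g| | g in S].

Definition combination (w : 'I_n -> R) : H :=
  \sum_(i < n) w i *: feature H (X i).

(* Since a / 0 = 0, all the new weights are 0 when the denominator vanishes,
   i.e. when the update is not otherwise defined. *)
Definition reweight (f : H) (i : 'I_n) : R :=
  varphi rho `|feature H (X i) - f| /
    \sum_(j < n) varphi rho `|feature H (X j) - f|.

Fixpoint kirwls_weight (w0 : 'I_n -> R) (m : nat) : 'I_n -> R :=
  match m with
  | 0%N => w0
  | m'.+1 => reweight (combination (kirwls_weight w0 m'))
  end.

(* The m-th iterate, meaningful for 1 <= m. *)
Definition kirwls (w0 : 'I_n -> R) (m : nat) : H :=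
  combination (kirwls_weight w0 m.-1).

End kirwls.

(* Main.v *)
(* Since [varphi] is nonincreasing, [rho] lies below the parabola
     r |-> rho s + varphi s / 2 * (r ^ 2 - s ^ 2),
   which touches it at [s].  Summing these majorizers at the distances
   |Phi X_i - f|, with [f'] the next iterate and [c] the mean of the
   [varphi |Phi X_i - f|], gives J f' <= J f - c / 2 * |f' - f| ^ 2, while
   V f = c (f' - f); hence |V f| ^ 2 <= 2 * varphi 0 * (J f - J f'), and V
   tends to 0 along the iterates.  These stay in the compact image of the cube
   [0, 1] ^ n, so that every cluster point is a zero of the continuous map V.
   When c = 0 the update is junk (f' = 0), but the same inequalities hold: the
   majorizer then gives J g <= J f for every g. *)
Require Import Defs.
From mathcomp Require Import all_boot all_order all_algebra.
From mathcomp Require Import all_classical all_reals all_analysis.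
From mathcomp Require Import ring lra.
Set Implicit Arguments.
Unset Strict Implicit.
Import Order.TTheory GRing.Theory Num.Theory.
Import numFieldNormedType.Exports.
Local Open Scope classical_set_scope.
Local Open Scope ring_scope.

(** * The loss on the half-line and its derivative *)

Section loss.
Variables (R : realType) (rho : R -> R).
Hypothesis rho_diff : loss_differentiable rho.

Lemma loss_quotient_cvg (x : R) : 0 <= x ->
  loss_quotient rho x y @[y --> within [set y | 0 <= y] x^'] --> psi rho x.
Proof. exact: rho_diff. Qed.

(** Off [x], [rho y] equals [rho x] plus the quotient times [y - x]. The endpoint 0 matters: the
    mean value theorem is later applied on intervals that may start there. *)
Lemma loss_continuous : {within [set x | 0 <= x], continuous rho}.
Proof.
apply/subspace_continuousP => x /= x0.
suff cvg_rho : rho y @[y --> within [set y | 0 <= y] x^'] --> rho x.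
  move=> A rhoxA; have := cvg_rho A rhoxA.
  rewrite /= /nbhs /= /within /= /dnbhs /within /=.
  apply: (@filterS _ (nbhs x)) => y yA y0.
  have [->|yx] := eqVneq y x; last exact: yA.
  exact: nbhs_singleton.
have FF : Filter (within [set y : R | 0 <= y] x^') by exact: within_filter.
pose q y := rho x + loss_quotient rho x y * (y - x).
have : q y @[y --> within [set y | 0 <= y] x^'] --> rho x + psi rho x * (x - x).
  apply: cvgD; first exact: cvg_cst.
  apply: cvgM; first exact: loss_quotient_cvg.
  apply: cvgB; last exact: cvg_cst.
  by do 2!apply: cvg_within_filter; exact: cvg_id.
rewrite subrr mulr0 addr0; apply: cvg_trans; apply: (@near_eq_cvg _ _ _ FF).
apply: (@filterS _ x^' _ (fun y => y != x)); last first.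
  by rewrite /dnbhs /within /=; near=> y.
move=> y + _; rewrite -subr_eq0 /q /loss_quotient => yx.
by rewrite divfK// addrC subrK.
Unshelve. all: by end_near. Qed.

(** Near a positive point the restriction to the half-line is void, so [psi] is there an ordinary
    two-sided derivative. *)
Lemma cvg_dnbhs_within_ge0 (x : R) : 0 < x ->
  y @[y --> x^'] --> within [set y : R | 0 <= y] x^'.
Proof.
move=> x0 A; rewrite /within /= => xA; near=> y.
have y0 : y >= 0 by apply: ltW; near: y; apply: nbhs_dnbhs; exact: lt_nbhsr.
by move: y0; near: y.
Unshelve. all: by end_near. Qed.

Lemma cvg_shift_dnbhs (x : R) : h + x @[h --> 0^'] --> x^'.
Proof.
move=> A /nbhs_ballP[e /= e0 eA].
apply/nbhs_ballP; exists e => //= h; rewrite /ball /= sub0r normrN => he h0.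
apply: eA; last by rewrite -subr_eq0 addrK.
by rewrite /ball /= opprD addrCA subrr addr0 normrN.
Qed.

Lemma loss_is_derive (x : R) : 0 < x -> is_derive x 1 rho (psi rho x).
Proof.
move=> x0.
suff cvg_rho : h^-1 *: ((rho \o shift x) (h *: 1) - rho x) @[h --> 0^'] -->
    psi rho x.
  by apply: DeriveDef; [apply: cvgP cvg_rho | exact: cvg_lim cvg_rho].
have -> : (fun h : R => h^-1 *: ((rho \o shift x) (h *: 1) - rho x)) =
    (loss_quotient rho x \o (fun h => h + x)).
  apply/funext => h; rewrite /loss_quotient /= addrK.
  by rewrite /GRing.scale /= mulr1 mulrC.
move=> A /(loss_quotient_cvg (ltW x0)) /(cvg_dnbhs_within_ge0 x0).
exact: cvg_shift_dnbhs.
Qed.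

Hypothesis A1 : assumption_A1 rho.

Lemma loss_ge0 (x : R) : 0 <= x -> 0 <= rho x.
Proof. by have [rho_nd rho0 _] := A1 => x0; rewrite -rho0 rho_nd. Qed.

Lemma varphi_pos (x : R) : 0 < x -> varphi rho x = psi rho x / x.
Proof. by move=> x0; rewrite /varphi gt_eqF. Qed.

Lemma psi_ge0 (x : R) : 0 < x -> 0 <= psi rho x.
Proof.
move=> x0; have [rho_nd _ _] := A1; have x_ge0 := ltW x0.
have FF : ProperFilter (within [set y : R | 0 <= y] x^').
  split; last exact: within_filter.
  by move=> /(cvg_dnbhs_within_ge0 x0); exact: filter_not_empty.
apply: limr_ge; first exact: rho_diff.
apply: (@filterE _ x^' _) => y y0; rewrite /loss_quotient.
have [xy|/ltW yx] := leP x y; first by rewrite divr_ge0 // subr_ge0 // rho_nd.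
rewrite -[rho y - _]opprB -[y - _]opprB invrN mulrNN.
by rewrite divr_ge0 // subr_ge0 // rho_nd.
Qed.

Hypothesis varphi_ni : varphi_nonincreasing rho.

(** Comparison with the point [x + 1], which is positive, also covers [x = 0], where [varphi] is a
    limit and not a quotient. *)
Lemma varphi_ge0 (x : R) : 0 <= x -> 0 <= varphi rho x.
Proof.
move=> x0; have x1_gt0 : 0 < x + 1 by lra.
apply: le_trans (varphi_ni x0 (y := x + 1) _); last by rewrite lerDl.
by rewrite varphi_pos // divr_ge0 ?psi_ge0 // ltW.
Qed.

(* The derivative [x * (varphi x - varphi s)] of the difference of the two sides
   changes sign at [s]. *)
Lemma loss_majorizer (s r : R) : 0 <= s -> 0 <= r ->
  rho r <= rho s + varphi rho s / 2 * (r ^+ 2 - s ^+ 2).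
Proof.
move=> s0 r0.
pose c := varphi rho s; pose h x := rho x - c / 2 * x ^+ 2.
suff : h r <= h s by rewrite /h -/c; lra.
have dh (x : R) : 0 < x -> is_derive x 1 h (x * (varphi rho x - c)).
  move=> x0; have := loss_is_derive x0 => dr.
  rewrite /h; apply: is_derive_eq.
  rewrite varphi_pos // /GRing.scale /=; field; lra.
have ch (a b : R) : 0 <= a -> {within `[a, b], continuous h}.
  move=> a0; have sub : `[a, b]%classic `<=` [set x : R | 0 <= x].
    by move=> x /=; rewrite in_itv /= => /andP[+ _]; exact: le_trans.
  apply: (continuous_subspaceW sub).
  move=> x; apply: cvgB; first exact: loss_continuous.
  apply: cvgM; first exact: cvg_cst.
  exact: (continuous_subspaceT (@exprn_continuous R 2)).
(* Even when [a = 0], the derivative is needed only at interior points, which are positive. *)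
have mvt (a b : R) : 0 <= a -> a < b -> exists2 x, x \in `]a, b[ &
    h b - h a = x * (varphi rho x - c) * (b - a).
  move=> a0 ab; apply: MVT => // x; last exact: ch.
  by rewrite in_itv /= => /andP[ax _]; apply: dh; lra.
have [sr|rs|->//] := ltgtP s r; rewrite -subr_le0.
  have [x + ->] := mvt _ _ s0 sr; rewrite in_itv /= => /andP[sx xr].
  have xc : varphi rho x <= c by apply: varphi_ni => //; exact: ltW.
  apply: mulr_le0_ge0; last by rewrite subr_ge0 ltW.
  by apply: mulr_ge0_le0; [exact: le_trans (ltW sx) | rewrite subr_le0].
have [x + hx] := mvt _ _ r0 rs; rewrite in_itv /= => /andP[rx xs].
have cx : c <= varphi rho x by apply: varphi_ni; lra.
rewrite -opprB hx oppr_le0; apply: mulr_ge0; last by rewrite subr_ge0 ltW.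
by apply: mulr_ge0; [exact: le_trans (ltW rx) | rewrite subr_ge0].
Qed.

End loss.

(** Filters on the indices replace subsequences: along any proper filter finer than [\oo], [u]
    clusters at a zero of [W]. The filter [\oo] itself yields existence; its trace on the indices
    far from the zeros yields a contradiction. *)
Lemma compact_cvg_zeros {R : realType} {H : normedModType R} {K : set H}
    {W : H -> H} {u : nat -> H} :
  compact K -> continuous W -> (forall m, K (u m)) ->
  W (u m) @[m --> \oo] --> 0 ->
  [set g | W g = 0] !=set0 /\
  inf [set `|u m - g| | g in [set g | W g = 0]] @[m --> \oo] --> (0 : R).
Proof.
move=> cK cW Ku Wu0.
have zero_cluster (F : set_system nat) : ProperFilter F -> \oo `<=` F ->
    exists2 p, W p = 0 & cluster (u @ F) p.
  move=> FF ooF.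
  have uK : (u @ F) K by exact: (@filterE _ F _).
  have [p [Kp clp]] := cK (u @ F) _ uK.
  (* Otherwise some [g] near [p] would have both [W g] and [W p - W g] of norm below half that of
     [W p]. *)
  exists p => //; apply: contrapT => /eqP; rewrite -normr_gt0 => Wp0.
  have e0 : 0 < `|W p| / 2 by lra.
  have near_p : nbhs p [set g | `|W p - W g| < `|W p| / 2].
    by apply: (@cvgr_dist_lt _ _ _ _ _ W (W p) (cW p)).
  have near_F : (u @ F) [set g | `|W g| < `|W p| / 2].
    apply: ooF; exact: (@cvgr0_norm_lt _ _ _ _ _ _ Wu0).
  have [g /= [Wg pg]] := clp _ _ near_F near_p.
  by have := ler_normD (W p - W g) (W g); rewrite subrK; lra.
have [p Wp _] := zero_cluster \oo _ (fun _ => id).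
have Z0 : [set g | W g = 0] !=set0 by exists p.
split=> //.
have dist_ge0 (g : H) : 0 <= inf [set `|g - h| | h in [set h | W h = 0]].
  apply: lb_le_inf => [|_ [q _ <-]]; last exact: normr_ge0.
  by case: Z0 => q Wq; exists `|g - q|; exists q.
apply/cvgr0Pnorm_lt => e e0; apply: contrapT => not_near.
pose far := [set m | e <= inf [set `|u m - g| | g in [set g | W g = 0]]].
(* Failure of convergence means that [far] meets every tail. *)
have far_proper : ProperFilter (within far \oo).
  split; last exact: within_filter.
  move=> h; apply: not_near; apply: (@filterS _ \oo _ _ _ _ h) => m.
  by move=> nfar; rewrite ger0_norm // ltNge; apply/negP => /nfar.
have [q Wq clq] := zero_cluster _ far_proper (cvg_within far).
(* The ball of radius [e] around the zero [q] must contain some [u m] with [m] in [far]. *)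
have far_u : (u @ within far \oo) [set u m | m in far].
  by apply: (@filterE _ \oo _) => m mfar; exists m.
have [_ [[m mfar <-] qm]] := clq _ _ far_u (nbhsx_ballx q e e0).
move: mfar qm; rewrite /far /= -ball_normE /= distrC => edist um.
suff : inf [set `|u m - g| | g in [set g | W g = 0]] <= `|u m - q| by lra.
apply: ge_inf; last by exists q.
by exists 0 => _ [g _ <-]; exact: normr_ge0.
Qed.

(** * One reweighting step: descent, continuity and compactness *)

Section kirwls.
Variables (R : realType) (T : Type) (k : T -> T -> R) (H : rkhs k).
Variables (rho : R -> R) (n : nat) (X : 'I_n -> T).
Hypotheses (rho_diff : loss_differentiable rho) (A1 : assumption_A1 rho).
Hypothesis varphi_ni : varphi_nonincreasing rho.

Lemma rkhs_sqr_normD (g h : H) :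
  `|g + h| ^+ 2 = `|g| ^+ 2 + 2 * rkhs_dot H g h + `|h| ^+ 2.
Proof.
rewrite !rkhs_normE linearDl /= !linearDr /=.
have -> : rkhs_dot H h g = rkhs_dot H g h.
  by rewrite hermC /= expr0 mul1r.
ring.
Qed.

Let a (f : H) i := varphi rho `|feature H (X i) - f|.
Let next (f : H) : H := combination H X (reweight rho X f).

Let a_ge0 f i : 0 <= a f i.
Proof. by rewrite varphi_ge0. Qed.

(** If the sum vanishes, so does each of its nonnegative terms; the degenerate update thus needs no
    separate treatment afterwards. *)
Lemma sum_varphi_reweight (f : H) i :
  (\sum_(j < n) varphi rho `|feature H (X j) - f|) * reweight rho X f i =
  varphi rho `|feature H (X i) - f|.
Proof.
rewrite /reweight mulrC.
have [s0|s_neq0] := eqVneq (\sum_(j < n) a f j) 0; last by rewrite divfK.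
by rewrite s0 mulr0 -/(a f i) (psumr_eq0P (fun j _ => a_ge0 f j) s0).
Qed.

(** First-order condition for the summed majorizer: [next f] is the barycentre of the features with
    masses [a f i]. *)
Lemma sum_varphi_combination (f : H) :
  \sum_(i < n) a f i *: (feature H (X i) - next f) = 0.
Proof.
under eq_bigr do rewrite scalerBr.
rewrite sumrB -scaler_suml; apply/eqP; rewrite subr_eq0; apply/eqP.
rewrite /next /combination scaler_sumr; apply: eq_bigr => i _.
by rewrite scalerA sum_varphi_reweight.
Qed.

Lemma V_next (f : H) :
  V rho X f = (n%:R^-1 * \sum_(i < n) a f i) *: (next f - f).
Proof.
rewrite /V -scalerA; congr (_ *: _).
rewrite scaler_suml; apply/eqP; rewrite -subr_eq0 -sumrB; apply/eqP.
rewrite -[RHS](sum_varphi_combination f); apply: eq_bigr => i _.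
by rewrite -scalerBr opprB addrA subrK.
Qed.

Lemma objective_descent (f : H) :
  n%:R^-1 * (\sum_(i < n) a f i) * `|next f - f| ^+ 2 <=
  2 * (objective rho X f - objective rho X (next f)).
Proof.
rewrite /objective -mulrBr -sumrB -[leLHS]mulrA [leRHS]mulrCA.
rewrite ler_wpM2l ?invr_ge0 //.
(* Huygens' identity: the cross terms cancel around the barycentre [next f]. *)
have -> : (\sum_(i < n) a f i) * `|next f - f| ^+ 2 = \sum_(i < n) a f i *
    (`|feature H (X i) - f| ^+ 2 - `|feature H (X i) - next f| ^+ 2).
  have expand i : `|feature H (X i) - f| ^+ 2 =
    `|feature H (X i) - next f| ^+ 2
    + 2 * rkhs_dot H (feature H (X i) - next f) (next f - f)
    + `|next f - f| ^+ 2.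
    by rewrite -rkhs_sqr_normD addrA subrK.
  have dot0 : \sum_(i < n) a f i *
     rkhs_dot H (feature H (X i) - next f) (next f - f) = 0.
    transitivity (rkhs_dot H
        (\sum_(i < n) a f i *: (feature H (X i) - next f)) (next f - f)).
      by rewrite linear_sumlz; apply: eq_bigr => i _; rewrite linearZl_LR.
    by rewrite sum_varphi_combination linear0l.
  have -> : \sum_(i < n) a f i *
      (`|feature H (X i) - f| ^+ 2 - `|feature H (X i) - next f| ^+ 2) =
      \sum_(i < n) (a f i * `|next f - f| ^+ 2 + 2 * (a f i *
        rkhs_dot H (feature H (X i) - next f) (next f - f))).
    by apply: eq_bigr => i _; rewrite expand; ring.
  by rewrite big_split /= -mulr_sumr dot0 mulr0 addr0 mulr_suml.
rewrite mulr_sumr; apply: ler_sum => i _.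
have := loss_majorizer rho_diff varphi_ni
  (normr_ge0 (feature H (X i) - f)) (normr_ge0 (feature H (X i) - next f)).
rewrite -/(a f i); lra.
Qed.

Lemma objective_next (f : H) : objective rho X (next f) <= objective rho X f.
Proof.
rewrite -subr_ge0 -(pmulr_rge0 _ (ltr0Sn R 1)).
apply: le_trans (objective_descent f).
by rewrite !mulr_ge0 ?invr_ge0 ?exprn_ge0 ?sumr_ge0.
Qed.

Lemma sqr_normV_le (f : H) : `|V rho X f| ^+ 2 <=
  varphi rho 0 * (2 * (objective rho X f - objective rho X (next f))).
Proof.
set c := n%:R^-1 * \sum_(i < n) a f i.
have c0 : 0 <= c by rewrite mulr_ge0 ?invr_ge0 ?sumr_ge0.
have cphi : c <= varphi rho 0.
  (* For [n = 0] the inverse of [n] is 0, hence [c = 0]. *)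
  rewrite /c; have [n0|n_gt0] := posnP n.
    by rewrite (_ : n%:R = 0) ?n0 // invr0 mul0r varphi_ge0.
  rewrite ler_pdivrMl ?ltr0n // mulr_natl -[X in _ *+ X]card_ord -sumr_const.
  by apply: ler_sum => i _; exact: varphi_ni.
(* Of the two factors [c] in the squared norm, one is bounded by [varphi rho 0] and the other is
   absorbed by the descent inequality. *)
rewrite V_next normrZ ger0_norm // exprMn expr2 -mulrA.
apply: ler_pM => //; first by rewrite mulr_ge0 ?exprn_ge0.
exact: objective_descent.
Qed.

Hypothesis A3 : assumption_A3 rho.

(** Continuity of [varphi] relative to the half-line suffices, since norms stay in it. *)
Lemma V_continuous : continuous (V rho X : H -> H).
Proof.
move=> g; apply: cvgZr.
apply: (cvg_big add_continuous) => i _.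
have dist_cvg : feature H (X i) - h @[h --> g] --> feature H (X i) - g.
  by apply: cvgB; [exact: cvg_cst | exact: cvg_id].
apply: cvgZ => //.
have [_ /subspace_continuousP phi_cont] := A3.
move=> A /(phi_cont _ (normr_ge0 _)) phiA.
have /(_ _) := cvg_norm dist_cvg phiA.
by apply: (@filterS _ (nbhs g)) => h; apply; exact: normr_ge0.
Qed.

(** Bounded sets of [H] need not be relatively compact; compactness comes from the
    finite-dimensional space of weights, encoded as row vectors. *)
Lemma compact_combination (K : set R) : compact K ->
  compact [set combination H X (w ord0) | w in
    [set w : 'rV[R]_n | forall i, K (w ord0 i)]].
Proof.
move=> cK; apply: continuous_compact; last first.
  exact: (@rV_compact _ _ (fun=> K) (fun=> cK)).
apply: continuous_subspaceT => w.
apply: (cvg_big add_continuous (F := nbhs w)) => i _.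
by apply: cvgZl; exact: coord_continuous.
Qed.

(** The cube is used and not the simplex, because degenerate weights are all 0 and do not sum to
    1. *)
Lemma reweight_itv01 (f : H) i : 0 <= reweight rho X f i <= 1.
Proof.
have s0 : 0 <= \sum_(j < n) a f j by exact: sumr_ge0.
apply/andP; split; first by rewrite divr_ge0 ?varphi_ge0.
rewrite /reweight; move: s0; rewrite le_eqVlt => /predU1P[<-|s_gt0].
  by rewrite invr0 mulr0.
rewrite ler_pdivrMr // mul1r (bigD1 i) //= lerDl.
by apply: sumr_ge0 => j _; exact: a_ge0.
Qed.

End kirwls.

Theorem theorem3 (R : realType) (d : nat)
    (k : d.-tuple R -> d.-tuple R -> R)
    (k_ge0 : forall x y, 0 <= k x y)
    (k_int : kernel_normalized k)
    (k_rad : kernel_radial k)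
    (k_psd : kernel_psd k)
    (H : rkhs k)
    (rho : R -> R)
    (rho_diff : loss_differentiable rho)
    (A1 : assumption_A1 rho)
    (A2 : assumption_A2 rho)
    (A3 : assumption_A3 rho)
    (phi_dec : varphi_nonincreasing rho)
    (n : nat) (X : 'I_n -> d.-tuple R)
    (w0 : 'I_n -> R)
    (w0_ge0 : forall i, 0 <= w0 i)
    (w0_sum : \sum_(i < n) w0 i = 1) :
  let f : nat -> H := kirwls H rho X w0 in
  let J : H -> R := objective rho X in
  let S : set H := stationary rho X in
  [/\ forall m : nat, (1 <= m)%N -> J (f m.+1) <= J (f m),
      cvg (J (f m) @[m --> \oo]),
      S !=set0
    & set_dist (f m) S @[m --> \oo] --> (0 : R)].
Proof.
move=> f J S.
pose w := kirwls_weight H rho X w0.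
(* The iterate of index [m.+1] uses the weights of index [m], so the argument runs on the shifted
   sequence from [f 1] on. *)
have fS m : f m.+2 = combination H X (reweight rho X (f m.+1)) by [].
have J_dec m : J (f m.+2) <= J (f m.+1) by rewrite fS; exact: objective_next.
have J_cvg : cvgn (fun m => J (f m.+1)).
  apply: nonincreasing_is_cvgn; first exact/nonincreasing_seqP.
  exists 0 => _ [m _ <-]; rewrite mulr_ge0 ?invr_ge0 // sumr_ge0 // => i _.
  exact: loss_ge0.
have w_itv m i : w m i \in `[0, 1].
  rewrite in_itv /=; case: m => [|m]; last exact: reweight_itv01.
  rewrite w0_ge0 -w0_sum (bigD1 i) //= lerDl.
  exact: sumr_ge0.
have V_cvg : V rho X (f m.+1) @[m --> \oo] --> (0 : H).
  (* Consecutive values of [J] share the limit [l], so their gap tends to 0. *)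
  have gap_cvg : varphi rho 0 * (2 * (J (f m.+1) - J (f m.+2))) @[m --> \oo] -->
      (0 : R).
    have /cvg_ex[l Jl] := J_cvg.
    have JSl : J (f m.+2) @[m --> \oo] --> l by rewrite -cvg_shiftS in Jl.
    set c := varphi rho 0.
    have -> : 0 = c * (2 * (l - l)) by rewrite subrr !mulr0.
    by do 2![apply: cvgM; first exact: cvg_cst]; exact: cvgB.
  apply/cvgr0Pnorm_lt => e e0.
  have e2 : 0 < e ^+ 2 by rewrite exprn_gt0.
  have /(_ _) := cvgr0_norm_lt _ gap_cvg _ e2; apply: filterS => m gap_m.
  rewrite -(ltr_pXn2r (n := 2)) ?nnegrE ?normr_ge0 ?(ltW e0) //.
  apply: le_lt_trans gap_m; apply: le_trans (ler_norm _).
  by rewrite fS; exact: sqr_normV_le.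
have cK := @compact_combination _ _ _ H _ X _ (@segment_compact R 0 1).
have f_in_K m : [set combination H X (v ord0) | v in
    [set v : 'rV[R]_n | forall i, v ord0 i \in `[0, 1]]] (f m.+1).
  exists (\row_i w m i); first by move=> i /=; rewrite mxE.
  by apply: eq_bigr => i _; rewrite mxE.
have [S0 dist0] := compact_cvg_zeros cK (V_continuous A3) f_in_K V_cvg.
split=> //.
- by case.
- apply/cvg_ex; have /cvg_ex[l Jl] := J_cvg; exists l.
  by rewrite -cvg_shiftS.
- by rewrite -cvg_shiftS.
Qed.
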